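(* Let $\mathcal{A}$ be a semi-abelian category, let $A$ and $B$ be simplicial objects in $\mathcal{A}$, and let $f,g\colon B\to A$ be semi-simplicial maps. If $f\simeq g$, i.e. $f$ and $g$ are simplicially homotopic, then $\mathrm{H}_nf=\mathrm{H}_ng\colon \mathrm{H}_nB\to\mathrm{H}_nA$ for every $n\in\mathbb{N}$.
   Context: A semi-abelian category is a category which is pointed, Barr exact (regular, with every equivalence relation a kernel pair), Bourn protomodular (the regular Short Five Lemma holds) and has binary coproducts. For a simplicial object $A$ in a semi-abelian category, the Moore complex $\mathrm{N}(A)$ has $\mathrm{N}_0A=A_0$, $\mathrm{N}_nA=\bigcap_{i=0}^{n-1}\mathrm{Ker}[\partial_i\colon A_n\to A_{n-1}]$ for $n\geq 1$, $\mathrm{N}_nA=0$ for $n<0$, and $d_n\colon \mathrm{N}_nA\to \mathrm{N}_{n-1}A$ the restriction of $\partial_n$. The homology object $\mathrm{H}_nA$ is the cokernel of the factorisation $d'_{n+1}\colon \mathrm{N}_{n+1}A\to \mathrm{Ker}[d_n]$ of $d_{n+1}$ over the kernel of $d_n$ (with $\mathrm{Ker}[d_0]=A_0$). $\mathrm{H}_n$ is functorial with respect to semi-simplicial maps, since only face operators are involved. A semi-simplicial map between simplicial objects is a family of maps commuting with all face operators $\partial_i$ but not necessarily with the degeneracies. Two semi-simplicial maps $f,g\colon B\to A$ are simplicially homotopic if there are maps $h^n_i\colon B_n\to A_{n+1}$, for $n\geq 0$ and $0\leq i\leq n$, with $\partial_0h^n_0=f_n$, $\partial_{n+1}h^n_n=g_n$,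 and $\partial_ih^n_j=h^{n-1}_{j-1}\partial_i$ for $i<j$, $\partial_ih^n_i=\partial_ih^n_{i-1}$ for $i=j\neq 0$, $\partial_ih^n_j=h^{n-1}_j\partial_{i-1}$ for $i>j+1$. *)

(* Defs.v *)
From mathcomp Require Import all_boot.
From mathcomp Require Import boolp.

Set Implicit Arguments.
Unset Strict Implicit.
Unset Printing Implicit Defensive.

Record category := Category {
  obj :> Type;
  hom : obj -> obj -> Type;
  idm : forall X, hom X X;
  comp : forall X Y Z, hom Y Z -> hom X Y -> hom X Z;
  compA : forall X Y Z W (h : hom Z W) (g : hom Y Z) (f : hom X Y),
    comp h (comp g f) = comp (comp h g) f;
  comp1m : forall X Y (f : hom X Y), comp (idm Y) f = f;
  compm1 : forall X Y (f : hom X Y), comp f (idm X) = f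
}.

Arguments hom {c}.
Arguments idm {c}.
Arguments comp {c X Y Z}.
Arguments compA {c X Y Z W}.
Arguments comp1m {c X Y}.
Arguments compm1 {c X Y}.

Declare Scope cat_scope.
Delimit Scope cat_scope with cat.
Local Open Scope cat_scope.
Notation "X ~> Y" := (hom X Y) (at level 90, no associativity) : cat_scope.
Notation "g ∘ f" := (comp g f) (at level 40, left associativity) : cat_scope.

Section Categories.
Context {C : category}.

Definition mono (X Y : C) (m : X ~> Y) : Prop :=
  forall (T : C) (a b : T ~> X), m ∘ a = m ∘ b -> a = b.

Definition iso (X Y : C) (f : X ~> Y) : Prop :=
  exists g : Y ~> X, g ∘ f = idm X /\ f ∘ g = idm Y.

Definition terminal (Z : C) : Prop :=
  forall X : C, exists! f : X ~> Z, True.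

Definition initial (Z : C) : Prop :=
  forall X : C, exists! f : Z ~> X, True.

Definition zero_object (Z : C) : Prop := initial Z /\ terminal Z.

Definition is_zero (X Y : C) (f : X ~> Y) : Prop :=
  exists (Z : C) (a : X ~> Z) (b : Z ~> Y), zero_object Z /\ f = b ∘ a.

(*     P --q--> Y
       |p       |g
       X --f--> Z   *)
Definition is_pullback (X Y Z P : C) (f : X ~> Z) (g : Y ~> Z)
    (p : P ~> X) (q : P ~> Y) : Prop :=
  f ∘ p = g ∘ q /\
  forall (T : C) (a : T ~> X) (b : T ~> Y), f ∘ a = g ∘ b ->
    exists! h : T ~> P, p ∘ h = a /\ q ∘ h = b.

Definition is_kernel_pair (X Y R : C) (f : X ~> Y) (r0 r1 : R ~> X) : Prop :=
  is_pullback f f r0 r1.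

Definition is_coequalizer (X Y Q : C) (u v : X ~> Y) (q : Y ~> Q) : Prop :=
  q ∘ u = q ∘ v /\
  forall (T : C) (t : Y ~> T), t ∘ u = t ∘ v -> exists! h : Q ~> T, h ∘ q = t.

Definition regular_epi (Y Q : C) (q : Y ~> Q) : Prop :=
  exists (X : C) (u v : X ~> Y), is_coequalizer u v q.

Definition is_kernel (X Y K : C) (f : X ~> Y) (k : K ~> X) : Prop :=
  is_zero (f ∘ k) /\
  forall (T : C) (t : T ~> X), is_zero (f ∘ t) -> exists! h : T ~> K, k ∘ h = t.

Definition is_cokernel (X Y Q : C) (f : X ~> Y) (q : Y ~> Q) : Prop :=
  is_zero (q ∘ f) /\
  forall (T : C) (t : Y ~> T), is_zero (t ∘ f) -> exists! h : Q ~> T, h ∘ q = t.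

Definition is_coproduct (X Y S : C) (i : X ~> S) (j : Y ~> S) : Prop :=
  forall (T : C) (a : X ~> T) (b : Y ~> T),
    exists! h : S ~> T, h ∘ i = a /\ h ∘ j = b.

Record equivalence_relation (X R : C) (r0 r1 : R ~> X) : Prop := {
  er_jointly_monic : forall (T : C) (a b : T ~> R),
    r0 ∘ a = r0 ∘ b -> r1 ∘ a = r1 ∘ b -> a = b;
  er_reflexive : exists s : X ~> R, r0 ∘ s = idm X /\ r1 ∘ s = idm X;
  er_symmetric : exists t : R ~> R, r0 ∘ t = r1 /\ r1 ∘ t = r0;
  er_transitive : forall (P : C) (p q : P ~> R), is_pullback r1 r0 p q ->
    exists t : P ~> R, r0 ∘ t = r0 ∘ p /\ r1 ∘ t = r1 ∘ q
}.

End Categories.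

Definition pointed (C : category) : Prop := exists Z : C, zero_object Z.

Record finitely_complete (C : category) : Prop := {
  fc_terminal : exists Z : C, terminal Z;
  fc_pullbacks : forall (X Y Z : C) (f : X ~> Z) (g : Y ~> Z),
    exists (P : C) (p : P ~> X) (q : P ~> Y), is_pullback f g p q
}.

Record regular (C : category) : Prop := {
  reg_finitely_complete : finitely_complete C;
  reg_coequalizers : forall (X Y R : C) (f : X ~> Y) (r0 r1 : R ~> X),
    is_kernel_pair f r0 r1 ->
    exists (Q : C) (q : X ~> Q), is_coequalizer r0 r1 q;
  reg_stable : forall (X Y Z P : C) (f : X ~> Z) (g : Y ~> Z)
      (p : P ~> X) (q : P ~> Y),
    is_pullback f g p q -> regular_epi f -> regular_epi q
}.

Record barr_exact (C : category) : Prop := {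
  ex_regular : regular C;
  ex_effective : forall (X R : C) (r0 r1 : R ~> X),
    equivalence_relation r0 r1 ->
    exists (Y : C) (f : X ~> Y), is_kernel_pair f r0 r1
}.

(* The regular Short Five Lemma:
     K' --k'--> E' --p'--> B'
     |u         |v         |w
     K  --k-->  E  --p-->  B   *)
Definition protomodular (C : category) : Prop :=
  forall (K' E' B' K E B : C) (k' : K' ~> E') (p' : E' ~> B')
    (k : K ~> E) (p : E ~> B) (u : K' ~> K) (v : E' ~> E) (w : B' ~> B),
    regular_epi p' -> is_kernel p' k' -> regular_epi p -> is_kernel p k ->
    v ∘ k' = k ∘ u -> p ∘ v = w ∘ p' ->
    iso u -> iso w -> iso v.

Definition has_binary_coproducts (C : category) : Prop :=
  forall X Y : C, exists (S : C) (i : X ~> S) (j : Y ~> S), is_coproduct i j.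

Record semi_abelian (C : category) : Prop := {
  sa_pointed : pointed C;
  sa_exact : barr_exact C;
  sa_protomodular : protomodular C;
  sa_coproducts : has_binary_coproducts C
}.

(* Operators are indexed by all natural numbers, but [face n i] is only
   meaningful for [i <= n.+1] and [degen n i] for [i <= n]: nothing is assumed
   or used about the other values. *)
Record simplicial (C : category) := Simplicial {
  sobj :> nat -> C;
  face : forall n, nat -> sobj n.+1 ~> sobj n;
  degen : forall n, nat -> sobj n ~> sobj n.+1;
  face_face : forall n i j, i < j -> j <= n.+2 ->
    face n i ∘ face n.+1 j = face n j.-1 ∘ face n.+1 i;
  degen_degen : forall n i j, i <= j -> j <= n ->
    degen n.+1 i ∘ degen n j = degen n.+1 j.+1 ∘ degen n i;
  face_degen_lt : forall n i j, i < j -> j <= n.+1 ->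
    face n.+1 i ∘ degen n.+1 j = degen n j.-1 ∘ face n i;
  face_degen_id : forall n i j, i = j \/ i = j.+1 -> j <= n ->
    face n i ∘ degen n j = idm (sobj n);
  face_degen_gt : forall n i j, j.+1 < i -> i <= n.+2 ->
    face n.+1 i ∘ degen n.+1 j = degen n j ∘ face n i.-1
}.

Arguments face {C} s n i.
Arguments degen {C} s n i.

Record semisimplicial_map (C : category) (B A : simplicial C) := SemiSimplicialMap {
  smap :> forall n, B n ~> A n;
  smap_face : forall n i, i <= n.+1 -> face A n i ∘ smap n.+1 = smap n ∘ face B n i
}.

(* As for faces, [h n i] is only meaningful for [i <= n]. *)
Record is_simplicial_homotopy (C : category) (B A : simplicial C)
    (f g : semisimplicial_map B A) (h : forall n, nat -> B n ~> A n.+1) : Prop := {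
  homotopy_first : forall n, face A n 0 ∘ h n 0 = f n;
  homotopy_last : forall n, face A n n.+1 ∘ h n n = g n;
  homotopy_lt : forall n i j, i < j -> j <= n.+1 ->
    face A n.+1 i ∘ h n.+1 j = h n j.-1 ∘ face B n i;
  homotopy_eq : forall n i, i != 0 -> i <= n ->
    face A n i ∘ h n i = face A n i ∘ h n i.-1;
  homotopy_gt : forall n i j, j.+1 < i -> i <= n.+2 ->
    face A n.+1 i ∘ h n.+1 j = h n j ∘ face B n i.-1
}.

Definition simplicially_homotopic (C : category) (B A : simplicial C)
    (f g : semisimplicial_map B A) : Prop :=
  exists h : forall n, nat -> B n ~> A n.+1, is_simplicial_homotopy f g h.

Section Zero.
Context {C : category}.

Lemma is_zero_compl (X Y Z : C) (f : X ~> Y) (g : Y ~> Z) :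
  is_zero f -> is_zero (g ∘ f).
Proof.
by move=> [O [a [b [hO ->]]]]; exists O, a, (g ∘ b); split=> //; rewrite compA.
Qed.

Lemma is_zero_compr (X Y Z : C) (f : X ~> Y) (g : Y ~> Z) :
  is_zero g -> is_zero (g ∘ f).
Proof.
by move=> [O [a [b [hO ->]]]]; exists O, (a ∘ f), b; split=> //; rewrite compA.
Qed.

Lemma is_zero_uniq (X Y : C) (f g : X ~> Y) : is_zero f -> is_zero g -> f = g.
Proof.
move=> [O [a [b [hO ->]]]] [O' [a' [b' [hO' ->]]]].
have [u [_ _]] := hO'.2 O.
have [x [_ hx]] := hO'.2 X; have [y [_ hy]] := hO.1 Y.
rewrite -(hx a' I) (hx (u ∘ a) I) -(hy b I) (hy (b' ∘ u) I).
by rewrite compA.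
Qed.

Lemma is_zero_ex (X Y : C) : pointed C -> exists f : X ~> Y, is_zero f.
Proof.
move=> [O hO]; have [a _] := hO.2 X; have [b _] := hO.1 Y.
by exists (b ∘ a), O, a, b.
Qed.

Lemma mono_is_zero (X Y Z : C) (m : Y ~> Z) (f : X ~> Y) :
  pointed C -> mono m -> is_zero (m ∘ f) -> is_zero f.
Proof.
move=> hC mm h; have [z hz] := is_zero_ex X Y hC.
suff -> : f = z by [].
by apply: mm; apply: is_zero_uniq => //; apply: is_zero_compl.
Qed.

End Zero.

(* Cokernels are not part of the definition of a semi-abelian category.  They
   exist because reflexive relations are equivalence relations (the Mal'tsev
   property) and therefore have coequalizers. *)

Section Cokernels.
Context {C : category} (hC : semi_abelian C).

Let hreg : regular C := ex_regular (sa_exact hC).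
Let hfc : finitely_complete C := reg_finitely_complete hreg.

Definition factors (X S T : C) (m : S ~> X) (x : T ~> X) : Prop :=
  exists h : T ~> S, m ∘ h = x.

Lemma factors_comp (X S T T' : C) (m : S ~> X) (x : T ~> X) (y : T' ~> T) :
  factors m x -> factors m (x ∘ y).
Proof. by move=> [h <-]; exists (h ∘ y); rewrite compA. Qed.

Lemma kernel_mono (X Y K : C) (f : X ~> Y) (k : K ~> X) : is_kernel f k -> mono k.
Proof.
move=> [kz ku] T a b e.
have [|h [_ hu]] := ku T (k ∘ a).
  by rewrite compA; apply: is_zero_compr.
by rewrite -(hu a) // -(hu b).
Qed.

Lemma regular_epi_epi (Y Q T : C) (q : Y ~> Q) (a b : Q ~> T) :
  regular_epi q -> a ∘ q = b ∘ q -> a = b.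
Proof.
move=> [X [u [v [e hq]]]] eab.
have [|h [_ hu]] := hq T (a ∘ q); first by rewrite -!compA e.
by rewrite -(hu a) // -(hu b).
Qed.

Lemma split_regular_epi (X Y : C) (p : X ~> Y) (s : Y ~> X) :
  p ∘ s = idm Y -> regular_epi p.
Proof.
move=> ps; exists X, (s ∘ p), (idm X); split.
  by rewrite compA ps comp1m compm1.
move=> T t et; exists (t ∘ s); split.
  by rewrite -compA et compm1.
by move=> h <-; rewrite -compA ps compm1.
Qed.

Lemma kernel_ex (X Y : C) (f : X ~> Y) : exists (K : C) (k : K ~> X), is_kernel f k.
Proof.
have [O hO] := sa_pointed hC.
have [z _] := hO.1 Y.
have [K [k [q [e hP]]]] := fc_pullbacks hfc f z.
exists K, k; split; first by exists O, q, z.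
move=> T t ht.
have [a [_ ha]] := hO.2 T.
have zz : is_zero (z ∘ a) by exists O, a, z.
have [h [[h1 h2] hu]] := hP T t a (is_zero_uniq ht zz).
exists h; split=> // h' e'; apply: hu; split=> //.
by rewrite -(ha (q ∘ h') I).
Qed.

Lemma product_ex (X Y : C) : exists (P : C) (p : P ~> X) (q : P ~> Y),
  forall (T : C) (a : T ~> X) (b : T ~> Y),
    exists! h : T ~> P, p ∘ h = a /\ q ∘ h = b.
Proof.
have [O hO] := fc_terminal hfc.
have [x _] := hO X; have [y _] := hO Y.
have [P [p [q [_ hP]]]] := fc_pullbacks hfc x y.
exists P, p, q => T a b; apply: hP.
by have [z [_ hz]] := hO T; rewrite -(hz (x ∘ a) I) -(hz (y ∘ b) I).
Qed.

(* A subobject containing the section and the kernel of a split epimorphism is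
   the whole object. *)
Lemma split_short_five (X Y S : C) (m : S ~> X) (p : X ~> Y) (s : Y ~> X) :
  mono m -> p ∘ s = idm Y -> factors m s ->
  (forall (T : C) (x : T ~> X), is_zero (p ∘ x) -> factors m x) ->
  factors m (idm X).
Proof.
move=> mm ps [s' es'] hk.
have [K' [k' hk']] := kernel_ex (p ∘ m).
have [K [k hK]] := kernel_ex p.
have [u [eu _]] : exists! u, k ∘ u = m ∘ k'.
  by apply: hK.2; rewrite compA; apply: hk'.1.
have [t et] := hk _ k hK.1.
have [v [ev _]] : exists! v, k' ∘ v = t.
  by apply: hk'.2; rewrite -compA et; apply: hK.1.
have pms : p ∘ m ∘ s' = idm Y by rewrite -compA es'.
have isou : iso u.
  exists v; split.
    apply: (kernel_mono hk'); rewrite compA ev compm1; apply: mm.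
    by rewrite compA et.
  apply: (kernel_mono hK); rewrite compA eu -compA ev et compm1 //.
have iso1 : iso (idm Y) by exists (idm Y); rewrite comp1m.
have [n [_ en]] : iso m.
  apply: (sa_protomodular hC (p' := p ∘ m) (split_regular_epi pms) hk'
    (split_regular_epi ps) hK (esym eu) _ isou iso1).
  by rewrite comp1m.
by exists n.
Qed.

Section Maltsev.
Context (Y R : C) (r0 r1 : R ~> Y) (s : Y ~> R).
Hypothesis (r_mono : forall (T : C) (a b : T ~> R),
  r0 ∘ a = r0 ∘ b -> r1 ∘ a = r1 ∘ b -> a = b).
Hypothesis (s0 : r0 ∘ s = idm Y) (s1 : r1 ∘ s = idm Y).

Let rel (T : C) (x y : T ~> Y) := exists a : T ~> R, r0 ∘ a = x /\ r1 ∘ a = y.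

Let rel_comp (T T' : C) (x y : T ~> Y) (t : T' ~> T) :
  rel x y -> rel (x ∘ t) (y ∘ t).
Proof. by move=> [a [<- <-]]; exists (a ∘ t); rewrite !compA. Qed.

Let rel_refl (T : C) (x : T ~> Y) : rel x x.
Proof. by exists (s ∘ x); rewrite !compA s0 s1 comp1m. Qed.

Let rel_sub (X : C) (a b : X ~> Y) : exists (S : C) (m : S ~> X),
  mono m /\ forall (T : C) (x : T ~> X), factors m x <-> rel (a ∘ x) (b ∘ x).
Proof.
have [Y2 [p [q hP]]] := product_ex Y Y.
have [r [[r0E r1E] _]] := hP R r0 r1.
have [c [[cE0 cE1] _]] := hP X a b.
have [S [m [n [e hS]]]] := fc_pullbacks hfc c r.
have eP T (x y : T ~> Y2) : p ∘ x = p ∘ y -> q ∘ x = q ∘ y -> x = y.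
  move=> e1 e2; have [h [_ hu]] := hP T (p ∘ x) (q ∘ x).
  by rewrite -(hu x) // -(hu y).
have n0 : r0 ∘ n = a ∘ m by rewrite -r0E -cE0 -!compA e.
have n1 : r1 ∘ n = b ∘ m by rewrite -r1E -cE1 -!compA e.
exists S, m; split.
  move=> T x y exy.
  have [|h [_ hu]] := hS T (m ∘ x) (n ∘ x); first by rewrite !compA e.
  rewrite -(hu x) // -(hu y) //; split=> //.
  by apply: r_mono; rewrite !compA ?n0 ?n1 -!compA exy.
move=> T x; split=> [[h <-]|[d [d0 d1]]].
  by exists (n ∘ h); rewrite !compA n0 n1.
have [|h [[h1 _] _]] := hS T x d; last by exists h.
by apply: eP; rewrite !compA ?r0E ?r1E ?cE0 ?cE1.
Qed.

Let rel_zero_sym (T : C) (x y : T ~> Y) : is_zero x -> rel x y -> rel y x.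
Proof.
move=> zx [a [a0 a1]].
have [K [k hk]] := kernel_ex r0.
have [K2 [p [q hP]]] := product_ex K K.
have [S [m [mm hm]]] := rel_sub (r1 ∘ k ∘ p) (r1 ∘ k ∘ q).
have [d [[pd qd] _]] := hP K (idm K) (idm K).
have [z zz] := is_zero_ex K K (sa_pointed hC).
have [c [[pc qc] _]] := hP K (idm K) z.
have hall : factors m (idm K2).
  apply: (split_short_five mm pd).
    by apply/hm; rewrite -!compA pd qd; apply: rel_refl.
  move=> T' t zt; apply/hm; exists (k ∘ (q ∘ t)); split.
    apply: is_zero_uniq.
      by rewrite compA; apply: is_zero_compr hk.1.
    by rewrite -!compA; do 2!apply: is_zero_compl.
  by rewrite !compA.
have /hm := factors_comp c hall.
rewrite comp1m -!compA pc qc compm1 => hr.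
have [|b [kb _]] := hk.2 T a; first by rewrite a0.
have := rel_comp b hr; rewrite -!compA kb a1.
suff -> : r1 ∘ (k ∘ (z ∘ b)) = x by [].
apply: is_zero_uniq => //.
by do 2!apply: is_zero_compl; apply: is_zero_compr.
Qed.

Lemma reflexive_equivalence : equivalence_relation r0 r1.
Proof.
split=> //; first by exists s.
  have [S [m [mm hm]]] := rel_sub r1 r0.
  have /hm : factors m (idm R).
    apply: (split_short_five mm s0).
      by apply/hm; rewrite s0 s1; apply: rel_refl.
    by move=> T x zx; apply/hm; apply: rel_zero_sym => //; exists x.
  by rewrite !compm1 => -[t ht]; exists t.
move=> P p q [epq hP].
have [S [m [mm hm]]] := rel_sub (r0 ∘ p) (r1 ∘ q).
have [|c [[pc qc] _]] := hP R (idm R) (s ∘ r1).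
  by rewrite compA s0 comp1m compm1.
have /hm : factors m (idm P).
  apply: (split_short_five mm pc).
    apply/hm; exists (idm R); rewrite -!compA pc qc !compm1 compA s1.
    by rewrite comp1m.
  move=> T x zx; apply/hm; exists (q ∘ x); split; last by rewrite compA.
  apply: is_zero_uniq; last by rewrite -compA; apply: is_zero_compl.
  by rewrite compA -epq -compA; apply: is_zero_compl.
by rewrite !compm1 => -[t ht]; exists t.
Qed.

End Maltsev.

Lemma image_ex (X Y : C) (h : X ~> Y) : exists (R : C) (e : X ~> R) (r : R ~> Y),
  [/\ regular_epi e, mono r & r ∘ e = h].
Proof.
have [K [k0 [k1 hK]]] := fc_pullbacks hfc h h.
have [R [e he]] := reg_coequalizers hreg hK.
have [r [er _]] := he.2 Y h hK.1.
have re : regular_epi e by exists K, k0, k1.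
exists R, e, r; split=> // T a b eab.
have [T1 [x [c [e1 P1]]]] := fc_pullbacks hfc e a.
have [T2 [y [d [e2 P2]]]] := fc_pullbacks hfc e (b ∘ c).
have rc : regular_epi c by apply: reg_stable re => //; split; [exact: e1|].
have rd : regular_epi d by apply: reg_stable re => //; split; [exact: e2|].
apply: (regular_epi_epi rc); apply: (regular_epi_epi rd).
have [|g [[g0 g1] _]] := hK.2 T2 (x ∘ d) y.
  by rewrite -er -!compA [e ∘ (_ ∘ _)]compA e1 e2 !compA eab.
by rewrite -e1 -e2 -compA -g0 -g1 !compA he.1.
Qed.

Lemma cokernel_ex (X Y : C) (f : X ~> Y) :
  exists (Q : C) (q : Y ~> Q), is_cokernel f q.
Proof.
have [S [i [j hS]]] := sa_coproducts hC X Y.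
have [z zz] := is_zero_ex X Y (sa_pointed hC).
have [u [[ui uj] _]] := hS Y f (idm Y).
have [v [[vi vj] _]] := hS Y z (idm Y).
have [Y2 [p [q hP]]] := product_ex Y Y.
have [w [[pw qw] _]] := hP S u v.
have [R [e [r [re mr er]]]] := image_ex w.
have r0e : p ∘ r ∘ e = u by rewrite -compA er.
have r1e : q ∘ r ∘ e = v by rewrite -compA er.
have hR : equivalence_relation (p ∘ r) (q ∘ r).
  apply: (reflexive_equivalence (s := e ∘ j)); rewrite ?compA ?r0e ?r1e //.
  move=> T a b; rewrite -!compA => e1 e2; apply: mr.
  have [h [_ hu]] := hP T (p ∘ (r ∘ a)) (q ∘ (r ∘ a)).
  by rewrite -(hu (r ∘ a)) // -(hu (r ∘ b)).
have [Z [g hg]] := ex_effective (sa_exact hC) hR.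
have [Q [c [ec hc]]] := reg_coequalizers hreg hg.
exists Q, c; split.
  by rewrite -ui -r0e !compA -[c ∘ p ∘ r]compA ec -!compA [q ∘ _]compA
    [_ ∘ (e ∘ i)]compA r1e vi; apply: is_zero_compl.
move=> T t tf; apply: hc; apply: (regular_epi_epi re).
rewrite -!compA [p ∘ _]compA [q ∘ _]compA r0e r1e.
have [h [_ hu]] := hS T (t ∘ f) t.
rewrite -(hu (t ∘ u)) ?(hu (t ∘ v)) // -!compA ?ui ?uj ?vi ?vj ?compm1 //.
by split=> //; apply: is_zero_uniq => //; apply: is_zero_compl.
Qed.

End Cokernels.

Record subobject (C : category) (X : C) := Subobject {
  sub_obj :> C;
  sub_arr : sub_obj ~> X;
  sub_mono : mono sub_arr
}.

Arguments sub_arr {C X} s.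
Arguments sub_mono {C X} s.

Section Subobjects.
Context {C : category}.

Lemma idm_mono (X : C) : mono (idm X).
Proof. by move=> T a b; rewrite !comp1m. Qed.

Definition sub_top (X : C) : subobject X := Subobject (@idm_mono X).

Definition factor (X T : C) (S : subobject X) (x : T ~> X)
  (hx : factors (sub_arr S) x) : T ~> S := sval (cid hx).

Lemma factorE (X T : C) (S : subobject X) (x : T ~> X)
  (hx : factors (sub_arr S) x) : sub_arr S ∘ factor hx = x.
Proof. exact: svalP (cid hx). Qed.

Lemma factors_top (X T : C) (x : T ~> X) : factors (sub_arr (sub_top X)) x.
Proof. by exists x; rewrite comp1m. Qed.

Context (hC : semi_abelian C).

Section Kernel.
Context (X Y : C) (f : X ~> Y).

Let kernel_obj : {K : C | exists k : K ~> X, is_kernel f k} :=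
  cid (kernel_ex hC f).
Let kernel_arr : {k : sval kernel_obj ~> X | is_kernel f k} :=
  cid (svalP kernel_obj).

Definition kernel : subobject X := Subobject (kernel_mono (svalP kernel_arr)).

Lemma kernelP : is_kernel f (sub_arr kernel).
Proof. exact: svalP kernel_arr. Qed.

Lemma factors_kernel (T : C) (x : T ~> X) :
  factors (sub_arr kernel) x <-> is_zero (f ∘ x).
Proof.
split=> [[h <-]|hx]; last by have [h [e _]] := kernelP.2 T x hx; exists h.
by rewrite compA; apply: is_zero_compr; apply: kernelP.1.
Qed.

End Kernel.

Section Meet.
Context (X : C) (S1 S2 : subobject X).

Lemma meet_ex : exists (P : C) (m : P ~> X), mono m /\
  exists (p : P ~> S1) (q : P ~> S2),
    is_pullback (sub_arr S1) (sub_arr S2) p q /\ m = sub_arr S1 ∘ p.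
Proof.
have [P [p [q hP]]] := fc_pullbacks (reg_finitely_complete
  (ex_regular (sa_exact hC))) (sub_arr S1) (sub_arr S2).
exists P, (sub_arr S1 ∘ p); split; last by exists p, q.
move=> T a b; rewrite -!compA => e.
have pe := sub_mono S1 _ _ _ e.
have qe : q ∘ a = q ∘ b by apply: (sub_mono S2); rewrite !compA -hP.1 -!compA.
have [|h [_ hu]] := hP.2 T (p ∘ a) (q ∘ a); first by rewrite !compA hP.1.
by rewrite -(hu a) // -(hu b).
Qed.

Let meet_obj := cid meet_ex.
Let meet_arr := cid (svalP meet_obj).

Definition meet : subobject X := Subobject (svalP meet_arr).1.

Lemma meetP : exists (p : meet ~> S1) (q : meet ~> S2),
  is_pullback (sub_arr S1) (sub_arr S2) p q /\ sub_arr meet = sub_arr S1 ∘ p.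
Proof. exact: (svalP meet_arr).2. Qed.

Lemma factors_meet (T : C) (x : T ~> X) : factors (sub_arr meet) x <->
  factors (sub_arr S1) x /\ factors (sub_arr S2) x.
Proof.
have [p [q [[e hP] ->]]] := meetP; split.
  move=> [h <-]; split; first by exists (p ∘ h); rewrite compA.
  by exists (q ∘ h); rewrite compA e.
move=> [[a ea] [b eb]].
have [|h [[hp _] _]] := hP T a b; first by rewrite ea.
by exists h; rewrite -compA hp.
Qed.

End Meet.

(* The intersection of [F 0, ..., F n.-1]; for [n = 0] it is [X] itself. *)
Fixpoint intersection (X : C) (n : nat) (F : nat -> subobject X) : subobject X :=
  if n is m.+1 then meet (intersection m F) (F m) else sub_top X.

Lemma factors_intersection (X T : C) (n : nat) (F : nat -> subobject X)
    (x : T ~> X) : factors (sub_arr (intersection n F)) x <->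
  forall i, i < n -> factors (sub_arr (F i)) x.
Proof.
elim: n => [|n IHn] /=; first by split=> // _; apply: factors_top.
apply: iff_trans (factors_meet _ _ _) _; rewrite IHn; split.
  by move=> [h1 h2] i; rewrite ltnS leq_eqVlt => /orP[/eqP->|/h1].
by move=> h; split=> [i /ltnW|]; apply: h.
Qed.

Section Cokernel.
Context (X Y : C) (f : X ~> Y).

Let cokernel_obj : {Q : C | exists q : Y ~> Q, is_cokernel f q} :=
  cid (cokernel_ex hC f).

Definition cokernel : C := sval cokernel_obj.
Definition coker : Y ~> cokernel := sval (cid (svalP cokernel_obj)).

Lemma cokerP : is_cokernel f coker.
Proof. exact: svalP (cid (svalP cokernel_obj)). Qed.

Lemma cokernel_desc_ex (T : C) (t : Y ~> T) : is_zero (t ∘ f) ->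
  exists h : cokernel ~> T, h ∘ coker = t.
Proof. by move=> ht; have [h [e _]] := cokerP.2 T t ht; exists h. Qed.

Definition cokernel_desc (T : C) (t : Y ~> T) (ht : is_zero (t ∘ f)) :
  cokernel ~> T := sval (cid (cokernel_desc_ex ht)).

Lemma cokernel_descE (T : C) (t : Y ~> T) (ht : is_zero (t ∘ f)) :
  cokernel_desc ht ∘ coker = t.
Proof. exact: svalP (cid (cokernel_desc_ex ht)). Qed.

End Cokernel.

End Subobjects.

Section Homology.
Context {C : category} (hC : semi_abelian C).

Section Objects.
Context (A : simplicial C).

Definition moore (n : nat) : subobject (A n) :=
  match n with
  | 0 => sub_top (A 0)
  | m.+1 => intersection hC m.+1 (fun i => kernel hC (face A m i))
  end.

Lemma factors_moore (n : nat) (T : C) (x : T ~> A n.+1) :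
  factors (sub_arr (moore n.+1)) x <->
  forall i, i <= n -> is_zero (face A n i ∘ x).
Proof.
apply: iff_trans (factors_intersection _ _ _ _) _.
by split=> h i /h /factors_kernel.
Qed.

Lemma moore_zero (n i : nat) : i <= n ->
  is_zero (face A n i ∘ sub_arr (moore n.+1)).
Proof.
move: i; apply/factors_moore; exists (idm _); exact: compm1.
Qed.

Lemma moore_d_factors (n : nat) :
  factors (sub_arr (moore n)) (face A n n.+1 ∘ sub_arr (moore n.+1)).
Proof.
case: n => [|n]; first exact: factors_top.
apply/factors_moore => i le_in.
have lt_in : i < n.+2 by rewrite ltnS leqW.
rewrite compA (face_face A lt_in (leqnn _)) -compA.
by apply: is_zero_compl; apply: moore_zero; apply: leqW.
Qed.

(* [moore_d n] is the differential [d_(n+1) : N_(n+1) A -> N_n A]. *)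
Definition moore_d (n : nat) : moore n.+1 ~> moore n := factor (moore_d_factors n).

Lemma moore_dE (n : nat) :
  sub_arr (moore n) ∘ moore_d n = face A n n.+1 ∘ sub_arr (moore n.+1).
Proof. exact: factorE. Qed.

(* [cycles n] is [Ker d_n], with [Ker d_0 = N_0 A = A_0]. *)
Definition cycles (n : nat) : subobject (moore n) :=
  match n with
  | 0 => sub_top (moore 0)
  | m.+1 => kernel hC (moore_d m)
  end.

Lemma cycles_d_factors (n : nat) : factors (sub_arr (cycles n)) (moore_d n).
Proof.
case: n => [|n]; first exact: factors_top.
apply/factors_kernel.
apply: (mono_is_zero (sa_pointed hC) (sub_mono (moore n))).
rewrite compA moore_dE -compA moore_dE compA.
rewrite (face_face A (leqnn _) (leqnn _)) -compA.
by apply: is_zero_compl; apply: moore_zero.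
Qed.

(* The factorisation [d'_(n+1) : N_(n+1) A -> Ker d_n] of [d_(n+1)]. *)
Definition cycles_d (n : nat) : moore n.+1 ~> cycles n :=
  factor (cycles_d_factors n).

Lemma cycles_dE (n : nat) : sub_arr (cycles n) ∘ cycles_d n = moore_d n.
Proof. exact: factorE. Qed.

Definition homology (n : nat) : C := cokernel hC (cycles_d n).

End Objects.

Section Maps.
Context (B A : simplicial C) (f : semisimplicial_map B A).

Lemma moore_map_factors (n : nat) :
  factors (sub_arr (moore A n)) (f n ∘ sub_arr (moore B n)).
Proof.
case: n => [|n]; first exact: factors_top.
apply/factors_moore => i le_in.
rewrite compA (smap_face f (leqW le_in)) -compA.
by apply: is_zero_compl; apply: moore_zero.
Qed.

Definition moore_map (n : nat) : moore B n ~> moore A n :=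
  factor (moore_map_factors n).

Lemma moore_mapE (n : nat) :
  sub_arr (moore A n) ∘ moore_map n = f n ∘ sub_arr (moore B n).
Proof. exact: factorE. Qed.

Lemma moore_map_d (n : nat) :
  moore_d A n ∘ moore_map n.+1 = moore_map n ∘ moore_d B n.
Proof.
apply: (sub_mono (moore A n)).
rewrite !compA moore_dE moore_mapE -!compA moore_mapE moore_dE.
by rewrite !compA smap_face.
Qed.

Lemma cycles_map_factors (n : nat) :
  factors (sub_arr (cycles A n)) (moore_map n ∘ sub_arr (cycles B n)).
Proof.
case: n => [|n]; first exact: factors_top.
apply/factors_kernel; rewrite compA moore_map_d -compA.
exact: is_zero_compl (kernelP hC _).1.
Qed.

Definition cycles_map (n : nat) : cycles B n ~> cycles A n :=
  factor (cycles_map_factors n).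

Lemma cycles_mapE (n : nat) :
  sub_arr (cycles A n) ∘ cycles_map n = moore_map n ∘ sub_arr (cycles B n).
Proof. exact: factorE. Qed.

Lemma homology_map_zero (n : nat) :
  is_zero (coker hC (cycles_d A n) ∘ cycles_map n ∘ cycles_d B n).
Proof.
suff e : cycles_map n ∘ cycles_d B n = cycles_d A n ∘ moore_map n.+1.
  by rewrite -compA e compA; apply: is_zero_compr (cokerP hC _).1.
apply: (sub_mono (cycles A n)).
by rewrite !compA cycles_mapE cycles_dE -compA cycles_dE moore_map_d.
Qed.

Definition homology_map (n : nat) : homology B n ~> homology A n :=
  cokernel_desc hC (homology_map_zero n).

Lemma homology_mapE (n : nat) :
  homology_map n ∘ coker hC (cycles_d B n) = coker hC (cycles_d A n) ∘ cycles_map n.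
Proof. exact: cokernel_descE. Qed.

End Maps.

End Homology.

(* Without this, [simpl] unfolds [moore A n.+1] into nested chosen limits. *)
Arguments sub_obj : simpl never.
Arguments sub_arr : simpl never.
Arguments kernel : simpl never.
Arguments meet : simpl never.
Arguments intersection : simpl never.
Arguments cokernel : simpl never.
Arguments moore : simpl never.
Arguments cycles : simpl never.

(* Main.v *)
(* Call x and y in Z_n = Ker d_n adjacent if some w in A_(n+1) has
   [face j w = x], [face j.+1 w = y] and all its other faces zero.  For a cycle
   x of B, the elements h_0 x, ..., h_n x form a chain of adjacent cycles from
   f x to g x, so it is enough that adjacent cycles have the same homology
   class.  For fixed j, the object W of all such w carries the split
   epimorphism [face j : W -> Z_n], with section [degen j].  Both classes agree
   on the section, and by protomodularity they agree on W as soon as they agree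
   on the kernel, that is, as soon as [face j.+1 w] is a boundary whenever it is
   the only nonzero face of w.  For j = n this is the definition of H_n; and
   this property for j.+1 gives the case j of the claim, which in turn gives the
   property for j on taking y = 0, so one descends from n to 0. *)

From mathcomp Require Import all_boot zify.
Require Import Defs.

Set Implicit Arguments.
Unset Strict Implicit.
Unset Printing Implicit Defensive.
Local Open Scope cat_scope.

(** * Equality of maps out of a split epimorphism *)

Section SplitEpimorphisms.
Context {C : category} (hC : semi_abelian C).

Lemma mono_comp (X Y Z : C) (m : Y ~> Z) (k : X ~> Y) :
  mono m -> mono k -> mono (m ∘ k).
Proof. by move=> mm mk T a b; rewrite -!compA => /mm/mk. Qed.

Lemma equalizer_ex (X Y : C) (u v : X ~> Y) : exists (E : C) (e : E ~> X),
  mono e /\ forall (T : C) (x : T ~> X), factors e x <-> u ∘ x = v ∘ x.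
Proof.
have [Y2 [p [q hP]]] := product_ex hC Y Y.
have [w [[pw qw] _]] := hP X u v.
have [d [[pd qd] _]] := hP Y (idm Y) (idm Y).
(* [E] is the pullback of the pairing [w] of [u] and [v] along the diagonal [d]. *)
have [E [e [r [er hE]]]] := fc_pullbacks (reg_finitely_complete
  (ex_regular (sa_exact hC))) w d.
have ue : u ∘ e = r by rewrite -pw -compA er compA pd comp1m.
have ve : v ∘ e = r by rewrite -qw -compA er compA qd comp1m.
exists E, e; split=> [T a b eab|T x].
  have erab : r ∘ a = r ∘ b by rewrite -ue -!compA eab.
  have [|h [_ hu]] := hE T (e ∘ a) (r ∘ a); first by rewrite !compA er.
  by rewrite -(hu a) // -(hu b).
split=> [[h <-]|uvx]; first by rewrite !compA ue ve.
have [|h [[eh _] _]] := hE T x (u ∘ x); last by exists h.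
have [c [_ hu]] := hP T (u ∘ x) (u ∘ x).
rewrite -(hu (w ∘ x)); last by rewrite !compA pw qw.
by apply: hu; rewrite !compA pd qd comp1m.
Qed.

(** The equalizer of [u] and [v] contains the section and the kernel of [p], so it is all of [X] by
    [split_short_five]. *)
Lemma split_epi_jointly_epi (X Y Z : C) (p : X ~> Y) (s : Y ~> X) (u v : X ~> Z) :
  p ∘ s = idm Y -> u ∘ s = v ∘ s ->
  (forall (T : C) (x : T ~> X), is_zero (p ∘ x) -> u ∘ x = v ∘ x) -> u = v.
Proof.
move=> ps us hk; have [E [e [me he]]] := equalizer_ex u v.
rewrite -[u]compm1 -[v]compm1; apply/he.
by apply: (split_short_five hC me ps) => [|T x /hk ux]; apply/he.
Qed.

Lemma preimage_ex (X Y : C) (f : X ~> Y) (S : subobject Y) :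
  exists R : subobject X, forall (T : C) (x : T ~> X),
    factors (sub_arr R) x <-> factors (sub_arr S) (f ∘ x).
Proof.
have [P [p [q [e hP]]]] := fc_pullbacks (reg_finitely_complete
  (ex_regular (sa_exact hC))) f (sub_arr S).
have mp : mono p.
  move=> T a b eab; have qab : q ∘ a = q ∘ b.
    by apply: (sub_mono S); rewrite !compA -e -!compA eab.
  have [|h [_ hu]] := hP T (p ∘ a) (q ∘ a); first by rewrite !compA e.
  by rewrite -(hu a) // -(hu b).
exists (Subobject mp) => T x; split=> [[h <-]|[h eh]].
  by exists (q ∘ h); rewrite !compA e.
by have [|c [[pc _] _]] := hP T x h; [rewrite eh | exists c].
Qed.

End SplitEpimorphisms.

(** * Adjacent cycles and their homology classes *)

Section AdjacentCycles.
Context {C : category} (hC : semi_abelian C) (A : simplicial C).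

(** Taken inside [A n] rather than inside [moore], so that being a cycle is a condition on faces
    alone. *)
Definition cycles_sub (n : nat) : subobject (A n) :=
  Subobject (mono_comp (sub_mono (moore hC A n)) (sub_mono (cycles hC A n))).

Lemma cycles_subE (n : nat) :
  sub_arr (cycles_sub n) = sub_arr (moore hC A n) ∘ sub_arr (cycles hC A n).
Proof. by []. Qed.

Definition homology_class (n : nat) : cycles_sub n ~> homology hC A n :=
  coker hC (cycles_d hC A n).

Lemma factors_cycles0 (T : C) (x : T ~> A 0) : factors (sub_arr (cycles_sub 0)) x.
Proof.
have [y ey] := factors_top x; have [z ez] := factors_top y.
by exists z; rewrite cycles_subE -compA -ey -ez.
Qed.

Lemma factors_cycles (n : nat) (T : C) (x : T ~> A n.+1) :
  factors (sub_arr (cycles_sub n.+1)) x <->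
  forall i, i <= n.+1 -> is_zero (face A n i ∘ x).
Proof.
rewrite cycles_subE; split=> [[c <-] i|hx].
  rewrite leq_eqVlt ltnS => /orP[/eqP->|le_in]; last first.
    rewrite !compA; apply: is_zero_compr; apply: is_zero_compr.
    exact: moore_zero.
  rewrite !compA -moore_dE -!compA; apply: is_zero_compl; rewrite compA.
  by apply: is_zero_compr; apply: (kernelP hC _).1.
have [|y ey] := (factors_moore hC (A := A) x).2; first by move=> i /leqW/hx.
have [|c ec] := (factors_kernel hC (moore_d hC A n) y).2; last first.
  by exists c; rewrite -compA ec.
apply: (mono_is_zero (sa_pointed hC) (sub_mono (moore hC A n))).
by rewrite compA moore_dE -compA ey; apply: hx.
Qed.

Lemma class_boundary (n : nat) (T : C) (w : T ~> A n.+1) (c : T ~> cycles_sub n) :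
  (forall i, i <= n -> is_zero (face A n i ∘ w)) ->
  sub_arr (cycles_sub n) ∘ c = face A n n.+1 ∘ w ->
  is_zero (homology_class n ∘ c).
Proof.
move=> /factors_moore[t <-] ec.
have -> : c = cycles_d hC A n ∘ t.
  apply: (sub_mono (cycles_sub n)); rewrite ec cycles_subE.
  by rewrite !compA -moore_dE -[_ ∘ cycles_d _ _ _]compA cycles_dE.
by rewrite compA; apply: is_zero_compr (cokerP hC _).1.
Qed.

(** For [j <= n] the first clause kills every face of [face A n j ∘ w] except the [j]-th; the second
    clause kills that one too. *)
Definition adjacency (n j : nat) (T : C) (w : T ~> A n.+1) : Prop :=
  (forall i, i <= n.+1 -> i != j -> i != j.+1 -> is_zero (face A n i ∘ w)) /\
  factors (sub_arr (cycles_sub n)) (face A n j ∘ w).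

(** The simplicial identities turn the faces of index other than [j] into faces of vanishing faces
    of [w]; the [j]-th is also the [j]-th face of the cycle [face A n j ∘ w]. *)
Lemma adjacency_target (n j : nat) (T : C) (w : T ~> A n.+1) :
  j <= n -> adjacency j w ->
  factors (sub_arr (cycles_sub n)) (face A n j.+1 ∘ w).
Proof.
case: n w => [|n] w le_jn [w0 wj]; first exact: factors_cycles0.
apply/factors_cycles => i le_in; rewrite compA.
have [lt_ij|lt_ji|->] := ltngtP i j.
- rewrite face_face ?(leqW lt_ij) //= -compA.
  by apply: is_zero_compl; apply: w0; lia.
- rewrite -(@face_face _ A n j.+1 i.+1) // -compA.
  by apply: is_zero_compl; apply: w0; lia.
- by rewrite face_face //= -compA; move/factors_cycles: wj; apply.
Qed.

Lemma adjacency_ex (n j : nat) : exists W : subobject (A n.+1),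
  forall (T : C) (w : T ~> A n.+1), factors (sub_arr W) w <-> adjacency j w.
Proof.
have [R hR] := preimage_ex hC (face A n j) (cycles_sub n).
(* [sub_top] imposes no condition at the two exempt indices. *)
pose F i := if (i == j) || (i == j.+1) then sub_top (A n.+1)
            else kernel hC (face A n i).
exists (meet hC (intersection hC n.+2 F) R) => T w.
apply: iff_trans (factors_meet _ _ _ _) _.
rewrite /adjacency hR; apply: and_iff_compat_r.
apply: iff_trans (factors_intersection _ _ _ _) _; split=> h i le_in.
  move=> ij ij1; have := h i le_in; rewrite /F (negPf ij) (negPf ij1).
  by move/factors_kernel.
rewrite /F; case: ifPn; first by move=> _; apply: factors_top.
by rewrite negb_or => /andP[ij ij1]; apply/factors_kernel/h.
Qed.

Lemma adjacency_degen (n j : nat) (T : C) (x : T ~> A n) :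
  j <= n -> factors (sub_arr (cycles_sub n)) x -> adjacency j (degen A n j ∘ x).
Proof.
move=> le_jn cx; split; last first.
  by rewrite compA face_degen_id ?comp1m //; left.
case: n x le_jn cx => [|n] x le_jn cx i le_in ij ij1; first lia.
move/factors_cycles: cx => cx; rewrite compA.
have [lt_ij|le_ji] := ltnP i j.
  rewrite face_degen_lt // -compA; apply/is_zero_compl/cx; lia.
rewrite face_degen_gt //; last lia.
rewrite -compA; apply/is_zero_compl/cx; lia.
Qed.

(** A zero class stands for being a boundary, since a generalized element with zero class need not
    lift along [cycles_d]. *)
Definition only_face_null (n k : nat) : Prop :=
  forall (T : C) (w : T ~> A n.+1) (c : T ~> cycles_sub n),
    (forall i, i <= n.+1 -> i != k -> is_zero (face A n i ∘ w)) ->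
    sub_arr (cycles_sub n) ∘ c = face A n k ∘ w ->
  is_zero (homology_class n ∘ c).

Lemma adjacency_class_step (n j : nat) (T : C) (w : T ~> A n.+1)
    (a b : T ~> cycles_sub n) :
  j <= n -> only_face_null n j.+1 -> adjacency j w ->
  sub_arr (cycles_sub n) ∘ a = face A n j ∘ w ->
  sub_arr (cycles_sub n) ∘ b = face A n j.+1 ∘ w ->
  homology_class n ∘ a = homology_class n ∘ b.
Proof.
move=> le_jn null_j1 adj_w ea eb; have zm := sub_mono (cycles_sub n).
(* It suffices to treat the universal adjacency [sub_arr W], with end cycles [p] and [q]; [w] is its
   restriction along [t] below. *)
have [W hW] := adjacency_ex n j.
have adj_W : adjacency j (sub_arr W) by apply/hW; exists (idm W); rewrite compm1.
have [p ep] := adj_W.2.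
have [q eqq] := adjacency_target le_jn adj_W.
have /hW[s es] : adjacency j (degen A n j ∘ sub_arr (cycles_sub n)).
  by apply: adjacency_degen => //; exists (idm _); rewrite compm1.
have ps : p ∘ s = idm _.
  apply: zm; rewrite compA ep -compA es compA face_degen_id //; last by left.
  by rewrite comp1m compm1.
have qs : q ∘ s = idm _.
  apply: zm; rewrite compA eqq -compA es compA face_degen_id //; last by right.
  by rewrite comp1m compm1.
have epq : homology_class n ∘ p = homology_class n ∘ q.
  apply: (split_epi_jointly_epi hC ps); first by rewrite -!compA ps qs.
  move=> V x zpx; rewrite -!compA.
  apply: is_zero_uniq; first exact: is_zero_compl.
  (* On the kernel of [p] the [j]-th face vanishes too, leaving only face [j.+1]. *)
  apply: (null_j1 _ (sub_arr W ∘ x)) => [i le_in ij1|]; last first.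
    by rewrite !compA eqq.
  have [->|ij] := eqVneq i j.
    by rewrite compA -ep -compA; apply: is_zero_compl.
  by rewrite compA; apply: is_zero_compr; apply: adj_W.1.
have /hW[t et] := adj_w.
have -> : a = p ∘ t by apply: zm; rewrite ea compA ep -compA et.
have -> : b = q ∘ t by apply: zm; rewrite eb compA eqq -compA et.
by rewrite !compA epq.
Qed.

Lemma only_face_nullP (n k : nat) : k <= n.+1 -> only_face_null n k.
Proof.
(* Descending induction on [k], as ascending induction on [d] with [k = n.+1 - d]. *)
move=> le_kn; rewrite -(subKn le_kn); move: (n.+1 - k) (leq_subr k n.+1) => {le_kn k}.
elim=> [|d IHd] le_dn T w c w0 ec.
  rewrite subn0 in w0 ec; apply: class_boundary ec => i le_in.
  by apply: w0; lia.
have ed : n.+1 - d = (n.+1 - d.+1).+1 by lia.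
have {}IHd := IHd (ltnW le_dn); rewrite ed in IHd.
move: (n.+1 - d.+1) (leq_subr d.+1 n.+1) ed w0 ec IHd => j le_jn ed w0 ec IHd.
(* [w] makes [c] adjacent to the zero cycle [b]. *)
have [b zb] := is_zero_ex T (cycles_sub n) (sa_pointed hC).
have -> : homology_class n ∘ c = homology_class n ∘ b; last exact: is_zero_compl.
apply: (adjacency_class_step (w := w) _ IHd) => //; first lia.
  split; last by exists c.
  by move=> i le_in ij _; apply: w0.
apply: is_zero_uniq; first exact: is_zero_compl.
by apply: w0; lia.
Qed.

Lemma adjacency_class (n j : nat) (T : C) (w : T ~> A n.+1)
    (a b : T ~> cycles_sub n) :
  j <= n -> adjacency j w ->
  sub_arr (cycles_sub n) ∘ a = face A n j ∘ w ->
  sub_arr (cycles_sub n) ∘ b = face A n j.+1 ∘ w ->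
  homology_class n ∘ a = homology_class n ∘ b.
Proof.
by move=> le_jn; apply: adjacency_class_step => //; apply: only_face_nullP.
Qed.

End AdjacentCycles.

(** * Simplicial homotopies as chains of adjacent cycles *)

Section Homotopy.
Context {C : category} (hC : semi_abelian C) (A B : simplicial C).

Lemma cycles_map_sub (f : semisimplicial_map B A) (n : nat) :
  sub_arr (cycles_sub hC A n) ∘ cycles_map hC f n =
  f n ∘ sub_arr (cycles_sub hC B n).
Proof.
by rewrite !cycles_subE -compA cycles_mapE !compA moore_mapE.
Qed.

Context (f g : semisimplicial_map B A) (h : forall n, nat -> B n ~> A n.+1).
Hypothesis hh : is_simplicial_homotopy f g h.

Lemma homotopy_adjacency (n j : nat) : j <= n ->
  factors (sub_arr (cycles_sub hC A n))
    (face A n j ∘ (h n j ∘ sub_arr (cycles_sub hC B n))) ->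
  adjacency hC j (h n j ∘ sub_arr (cycles_sub hC B n)).
Proof.
case: n => [|n] le_jn cj; split=> // i le_in ij ij1; first lia.
have cB := (factors_cycles hC (sub_arr (cycles_sub hC B n.+1))).1
  (ex_intro _ (idm _) (compm1 _)).
rewrite compA; have [lt_ij|le_ji] := ltnP i j.
  by rewrite (homotopy_lt hh) // -compA; apply/is_zero_compl/cB; lia.
rewrite (homotopy_gt hh) //; last lia.
by rewrite -compA; apply/is_zero_compl/cB; lia.
Qed.

Lemma homotopy_chain (n j : nat) : j <= n ->
  exists2 b, sub_arr (cycles_sub hC A n) ∘ b =
             face A n j.+1 ∘ (h n j ∘ sub_arr (cycles_sub hC B n)) &
             homology_class hC A n ∘ cycles_map hC f n = homology_class hC A n ∘ b.
Proof.
(* The induction runs on the source face [j] of [h n j]: it is [f n] for [j = 0], and [homotopy_eq]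
   identifies the target of [h n j] with the source of [h n j.+1]. *)
move=> le_jn; suff [a ea <-] : exists2 a, sub_arr (cycles_sub hC A n) ∘ a =
      face A n j ∘ (h n j ∘ sub_arr (cycles_sub hC B n)) &
    homology_class hC A n ∘ a = homology_class hC A n ∘ cycles_map hC f n.
  have adj := homotopy_adjacency le_jn (ex_intro _ a ea).
  have [b eb] := adjacency_target le_jn adj.
  by exists b => //; apply: adjacency_class ea eb.
elim: j le_jn => [|j IHj] le_jn.
  exists (cycles_map hC f n) => //.
  by rewrite cycles_map_sub compA (homotopy_first hh).
have [a ea ca] := IHj (ltnW le_jn).
have adj := homotopy_adjacency (ltnW le_jn) (ex_intro _ a ea).
have [b eb] := adjacency_target (ltnW le_jn) adj.
exists b; first by rewrite eb !compA (homotopy_eq hh).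
by rewrite -ca; apply/esym; apply: adjacency_class ea eb; first exact: ltnW.
Qed.

End Homotopy.

Theorem corollary4p9 (C : category) (hC : semi_abelian C) (A B : simplicial C)
    (f g : semisimplicial_map B A) :
  simplicially_homotopic f g ->
  forall n : nat, homology_map hC f n = homology_map hC g n.
Proof.
move=> [h hh] n.
have [b eb cb] := homotopy_chain hC hh (leqnn n).
have eg : b = cycles_map hC g n.
  apply: (sub_mono (cycles_sub hC A n)).
  by rewrite eb cycles_map_sub compA (homotopy_last hh).
(* Both maps on homology factor the same map through the cokernel, so uniqueness applies. *)
have [u [_ hu]] := (cokerP hC (cycles_d hC B n)).2 _ _ (homology_map_zero hC f n).
rewrite -(hu (homology_map hC f n)); last by rewrite homology_mapE.
apply: hu; rewrite homology_mapE -eg; exact: esym cb.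
Qed.
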